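(* Let $U=\begin{pmatrix} A_{U} & B_{U}\\ C_{U} & D_{U}\end{pmatrix}$ and $V=\begin{pmatrix} A_{V} & B_{V}\\ C_{V} & D_{V}\end{pmatrix}$ be complex square block matrices of the same size, partitioned in the same way, with $A_U,A_V\in\mathbb{C}^{n\times n}$, $B_U,B_V\in\mathbb{C}^{n\times s}$, $C_U,C_V\in\mathbb{C}^{s\times n}$, $D_U,D_V\in\mathbb{C}^{s\times s}$. Assume that $D_{U}^{\#}$ and $D_{V}^{\#}$ exist, and let $L_{U}=A_{U}-B_{U}D_{U}^\# C_{U}$ and $L_{V}=A_{V}-B_{V}D_{V}^\# C_{V}$. Suppose that $R(C_{V})\subseteq R(D_{V})$, $R((D_{V}^\# C_{V})^* )\subseteq R(L_{V}^* )$, $R(B_{U}^* )\subseteq R(D_{U}^* )$ and $R(B_{U}D_{U}^\#)\subseteq R(L_{U})$. If $(U,V)$ is a group inverse absorbing pair, then $(L_{U},L_{V})$ is also a group inverse absorbing pair.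
   Context: $R(X)$ denotes the range (column space) of a matrix $X$ and $X^*$ its conjugate transpose. A square matrix $X$ is group invertible if there is a matrix $Y$ with $XYX=X$, $YXY=Y$ and $XY=YX$; such a $Y$ is unique, is called the group inverse of $X$, and is denoted $X^{\#}$. For square complex matrices $P,Q$ of the same size, the pair $(P,Q)$ is called a group inverse absorbing pair if both $P$ and $Q$ are group invertible and $P^\#+Q^\#=P^\#(P+Q)Q^\#$. *)

(* Defs.v *)
From mathcomp Require Import all_boot all_order all_algebra.
From mathcomp Require Import sesquilinear spectral.
From mathcomp Require Import complex boolp classical_sets reals.

Set Implicit Arguments.
Unset Strict Implicit.
Unset Printing Implicit Defensive.

Import GRing.Theory Num.Theory.
Local Open Scope ring_scope.
Local Open Scope classical_set_scope.

(* Columns, not rows: the subspace order of mxalgebra compares row spaces. *)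
Definition mxrange (F : fieldType) (m n : nat) (X : 'M[F]_(m, n)) :
  set 'cV[F]_m := range (fun v : 'cV[F]_n => X *m v).

Definition is_group_inverse (F : fieldType) (n : nat) (X Y : 'M[F]_n) : Prop :=
  [/\ X *m Y *m X = X, Y *m X *m Y = Y & X *m Y = Y *m X].

Definition group_invertible (F : fieldType) (n : nat) (X : 'M[F]_n) : Prop :=
  exists Y, is_group_inverse X Y.

(* Total; the value 0 when X is not group invertible is junk. *)
Definition group_inverse (F : fieldType) (n : nat) (X : 'M[F]_n) : 'M[F]_n :=
  xget 0 [set Y | is_group_inverse X Y].

Notation "X ^#" := (group_inverse X) (at level 2, format "X ^#") : ring_scope.

Definition group_inverse_absorbing (F : fieldType) (n : nat)
    (P Q : 'M[F]_n) : Prop :=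
  [/\ group_invertible P, group_invertible Q
    & P^# + Q^# = P^# *m (P + Q) *m Q^#].

Lemma is_group_inverse_uniq (F : fieldType) (n : nat) (X Y Z : 'M[F]_n) :
  is_group_inverse X Y -> is_group_inverse X Z -> Y = Z.
Proof.
move=> [Y1 Y2 Y3] [Z1 Z2 Z3].
have e : X *m Y = X *m Z.
  by rewrite -{1}Z1 -mulmxA Y3 Z3 -!mulmxA [X *m (Y *m X)]mulmxA Y1.
by rewrite -Y2 -mulmxA e mulmxA -Y3 e Z3 Z2.
Qed.

Lemma group_inverseP (F : fieldType) (n : nat) (X : 'M[F]_n) :
  group_invertible X -> is_group_inverse X X^#.
Proof. by move=> /(@xgetPex _ 0 [set Y | is_group_inverse X Y]). Qed.

(* Main.v *)
(** With [E = (1; - D_V^# C_V)], [F = (1; 0)] and [E' = (1, - B_U D_U^#)], the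
    hypotheses give [V E = F L_V] and [E' U = L_U F^T].  Multiplying the
    absorption identity by [U^# U] on the left shows that, for group invertible
    [U] and [V], it means [R(V) <= R(U)] together with inclusion of the row
    space of [U] in that of [V]; both inclusions pass to [L_U] and [L_V].
    The two remaining range hypotheses are only used to show that [L_U] and
    [L_V] are group invertible, by factoring [L_V] as [Z L_V^2], and dually. *)
Require Import Defs.
From mathcomp Require Import all_boot all_order all_algebra.
From mathcomp Require Import sesquilinear spectral.
From mathcomp Require Import complex boolp classical_sets reals.
Set Implicit Arguments.
Unset Strict Implicit.
Import GRing.Theory Num.Theory.
Local Open Scope complex_scope.
Local Open Scope sesquilinear_scope.
Local Open Scope classical_set_scope.
Local Open Scope ring_scope.

Lemma mxrange_subP (F : fieldType) (m n p : nat)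
    (X : 'M[F]_(m, n)) (Y : 'M[F]_(m, p)) :
  mxrange X `<=` mxrange Y <-> exists Z, X = Y *m Z.
Proof.
split=> [sXY | [Z ->] _ [v _ <-]]; last by exists (Z *m v) => //; rewrite mulmxA.
(* Transposing turns columns into rows, so the library's row space order applies; each column of [X]
   is the image of a unit vector. *)
suff /submxP[Z eZ] : (X^T <= Y^T)%MS.
  by exists Z^T; apply: trmx_inj; rewrite eZ trmx_mul trmxK.
apply/row_subP => j; rewrite -tr_col.
have [|v _ eXv] := sXY (col j X); first by exists (delta_mx j 0) => //; rewrite colE.
by rewrite -eXv trmx_mul submxMl.
Qed.

Lemma mxrange_trC_sub (C : numClosedFieldType) (m n p : nat)
    (X : 'M[C]_(m, n)) (Y : 'M[C]_(p, n)) :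
  mxrange (X^t*) `<=` mxrange (Y^t*) -> exists Z, X = Z *m Y.
Proof.
move=> /mxrange_subP[Z eZ]; exists (Z^t*).
by rewrite -[X]trmxCK eZ trmx_mul map_mxM trmxCK.
Qed.

(** The factorization forces [L] and [L *m L] to have equal rank, hence equal column spaces, so also
    [L = L *m L *m W]. The group inverse is then [Z *m L *m W]. *)
Lemma group_invertible_sqr (F : fieldType) (n : nat) (L Z : 'M[F]_n) :
  L = Z *m (L *m L) -> group_invertible L.
Proof.
move=> eZ.
have /submxP[W' eW'] : (L^T <= (L *m L)^T)%MS.
  rewrite -(geq_leqif (mxrank_leqif_sup _)); last by rewrite trmx_mul submxMl.
  by rewrite !mxrank_tr {1}eZ mxrankM_maxr.
pose W := W'^T.
have eW : L = L *m L *m W.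
  by apply: trmx_inj; rewrite eW' [RHS]trmx_mul trmxK.
have LW : L *m W = Z *m L by rewrite [in RHS]eW !mulmxA -(mulmxA Z) -eZ.
have LG : L *m (Z *m L *m W) = L *m W by rewrite -LW !mulmxA -eW.
have GL : Z *m L *m W *m L = L *m W.
  by rewrite -(mulmxA Z) LW -!mulmxA -eZ.
exists (Z *m L *m W); split; last by rewrite LG GL.
  by rewrite LG LW -mulmxA -eZ.
by rewrite GL LW -mulmxA LG mulmxA.
Qed.

Lemma group_invertible_tr (F : fieldType) (n : nat) (X : 'M[F]_n) :
  group_invertible X -> group_invertible X^T.
Proof.
move=> [Y [XYX YXY XY]]; exists Y^T; split; rewrite -!trmx_mul.
- by rewrite mulmxA XYX.
- by rewrite mulmxA YXY.
- by rewrite XY.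
Qed.

(** The absorption identity splits into [P^# = P^# *m Q *m Q^#] and [Q^# = P^# *m P *m Q^#]; the
    first encodes the factorization of [P], the second that of [Q]. *)
Lemma group_inverse_absorbingP (F : fieldType) (n : nat) (P Q : 'M[F]_n) :
  group_invertible P -> group_invertible Q ->
  group_inverse_absorbing P Q <->
  (exists S, P = S *m Q) /\ (exists T, Q = P *m T).
Proof.
move=> gP gQ.
have [P1 P2 P3] := group_inverseP gP; have [Q1 Q2 Q3] := group_inverseP gQ.
split=> [[_ _ ePQ] | [[S eS] [T eT]]].
  have ePQr : P^# = P^# *m Q *m Q^#.
    have := congr1 (mulmx (P^# *m P)) ePQ.
    by rewrite !(mulmxDr, mulmxDl) !mulmxA P2 addrC => /addrI.
  have ePQl : Q^# = P^# *m P *m Q^#.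
    by have := ePQ; rewrite mulmxDr mulmxDl -ePQr addrC => /addIr.
  split.
    exists (P *m Q^#).
    have PP : P *m P *m P^# = P by rewrite -mulmxA P3 mulmxA P1.
    by rewrite -mulmxA -Q3 -{1}PP ePQr !mulmxA PP.
  exists (P^# *m Q).
  have QQ : Q^# *m Q *m Q = Q by rewrite -Q3 Q1.
  by rewrite mulmxA P3 -{1}QQ ePQl -!mulmxA (mulmxA Q^#) QQ.
have ePQr : P^# = P^# *m Q *m Q^#.
  have PQ : P *m Q *m Q^# = P by rewrite -mulmxA Q3 {1}eS -mulmxA (mulmxA Q) Q1.
  by rewrite -{1}P2 -mulmxA P3 -[X in _ *m (_ *m X)]PQ !mulmxA -(mulmxA _ P^# P) -P3 mulmxA P2.
have ePQl : Q^# = P^# *m P *m Q^#.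
  have PQ : P^# *m P *m Q = Q by rewrite -P3 eT mulmxA P1.
  by rewrite -{1}Q2 -Q3 -[X in X *m _ *m _]PQ -!mulmxA (mulmxA Q) Q3 Q2.
split=> //.
by rewrite mulmxDr mulmxDl -ePQr -ePQl addrC.
Qed.

(** With [L] the Schur complement, [V *m E] is [L] stacked on zero, and one more product with [V]
    gives [K *m (L *m L)]. Since [V^# *m V *m V = V], applying [V^#] and keeping the top block
    writes [L] as a left multiple of its square. *)
Lemma schur_complement_group_invertible (F : fieldType) (n s : nat)
    (A : 'M[F]_n) (B : 'M[F]_(n, s)) (C : 'M[F]_(s, n)) (D : 'M[F]_s)
    (X Y : 'M[F]_(s, n)) :
  D *m X = C -> X = Y *m (A - B *m X) ->
  group_invertible (block_mx A B C D) -> group_invertible (A - B *m X).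
Proof.
set V := block_mx A B C D; set L := A - B *m X => DX eX gV.
have [V1 _ V3] := group_inverseP gV.
pose E : 'M[F]_(n + s, n) := col_mx 1%:M (- X).
pose K : 'M[F]_(n + s, n) := col_mx 1%:M 0 + V *m col_mx 0 Y.
have VE : V *m E = col_mx L 0.
  by rewrite mul_block_col !mulmx1 !mulmxN DX subrr.
have EL : E *m L = col_mx L 0 - col_mx 0 Y *m (L *m L).
  by rewrite !mul_col_mx mul1mx mul0mx mulNmx opp_col_mx add_col_mx oppr0 addr0 add0r mulmxA -eX.
have VF : V *m col_mx L 0 = K *m (L *m L).
  apply/eqP; rewrite mulmxDl -mulmxA -subr_eq -mulmxBr -EL (mulmxA V) VE.
  by rewrite !mul_col_mx !mul0mx mul1mx.
apply: (@group_invertible_sqr _ _ _ (row_mx 1%:M 0 *m V^# *m K)).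
rewrite -mulmxA -VF -VE !mulmxA -(mulmxA _ V^#) -V3 -!mulmxA (mulmxA V) (mulmxA (V *m _)) V1 VE.
by rewrite mul_row_col mul1mx mul0mx addr0.
Qed.

Theorem theorem4p6 (R : realType) (n s : nat)
    (AU AV : 'M[R[i]]_n) (BU BV : 'M[R[i]]_(n, s))
    (CU CV : 'M[R[i]]_(s, n)) (DU DV : 'M[R[i]]_s)
    (hDU : group_invertible DU) (hDV : group_invertible DV) :
  let U := block_mx AU BU CU DU in
  let V := block_mx AV BV CV DV in
  let LU := AU - BU *m DU^# *m CU in
  let LV := AV - BV *m DV^# *m CV in
  mxrange CV `<=` mxrange DV ->
  mxrange ((DV^# *m CV)^t*) `<=` mxrange (LV^t*) ->
  mxrange (BU^t*) `<=` mxrange (DU^t*) ->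
  mxrange (BU *m DU^#) `<=` mxrange LU ->
  group_inverse_absorbing U V ->
  group_inverse_absorbing LU LV.
Proof.
move=> U V LU LV hCV hDCV hBU hBDU gUV.
have [DU1 _ _] := group_inverseP hDU.
have [DV1 _ _] := group_inverseP hDV.
have [gU gV _] := gUV.
have [[S eS] [T eT]] := (group_inverse_absorbingP gU gV).1 gUV.
have CVE : DV *m (DV^# *m CV) = CV.
  by have /mxrange_subP[Z ->] := hCV; rewrite !mulmxA DV1.
have BUE : BU *m DU^# *m DU = BU.
  by have [Z ->] := mxrange_trC_sub hBU; rewrite -!mulmxA (mulmxA DU) DU1.
have gLV : group_invertible LV.
  have [Y eY] := mxrange_trC_sub hDCV; rewrite /LV -mulmxA.
  by apply: (schur_complement_group_invertible CVE _ gV); rewrite [in RHS]mulmxA; exact: eY.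
have gLU : group_invertible LU.
  have /mxrange_subP[Y eY] := hBDU.
  (* Transposition exchanges the two off-diagonal blocks, so the row conditions on [BU] become the
     column conditions of the Schur complement lemma. *)
  have eLU : LU^T = AU^T - CU^T *m (BU *m DU^#)^T by rewrite linearB /= -trmx_mul.
  rewrite -[LU]trmxK; apply: group_invertible_tr; rewrite eLU.
  apply: (@schur_complement_group_invertible _ _ _ _ _ BU^T DU^T _ Y^T).
  - by rewrite -trmx_mul BUE.
  - by rewrite -eLU -trmx_mul -eY.
  - by rewrite -tr_block_mx; apply: group_invertible_tr.
pose E : 'M[R[i]]_(n + s, n) := col_mx 1%:M (- (DV^# *m CV)).
pose F : 'M[R[i]]_(n + s, n) := col_mx 1%:M 0.
pose E' : 'M[R[i]]_(n, n + s) := row_mx 1%:M (- (BU *m DU^#)).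
pose F' : 'M[R[i]]_(n, n + s) := row_mx 1%:M 0.
have VE : V *m E = F *m LV.
  by rewrite mul_block_col !mulmx1 !mulmxN CVE subrr mul_col_mx mul1mx mul0mx mulmxA.
have EU : E' *m U = LU *m F'.
  by rewrite mul_row_block !mul1mx !mulNmx BUE subrr mul_mx_row mulmx1 mulmx0.
have F'E : F' *m E = 1%:M by rewrite mul_row_col mulmx1 mul0mx addr0.
have E'F : E' *m F = 1%:M by rewrite mul_row_col mulmx1 mulmx0 addr0.
apply/(group_inverse_absorbingP gLU gLV); split.
  (* [LU = LU *m F' *m E = E' *m U *m E = E' *m S *m V *m E], and [V *m E = F *m LV]. *)
  by exists (E' *m S *m F); rewrite -(mulmxA _ F) -VE mulmxA -(mulmxA E') -eS EU -mulmxA F'E mulmx1.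
(* Dually, [LV = E' *m F *m LV = E' *m V *m E = E' *m U *m T *m E], and [E' *m U = LU *m F']. *)
by exists (F' *m T *m E); rewrite !mulmxA -EU -(mulmxA _ U) -eT -mulmxA VE mulmxA E'F mul1mx.
Qed.
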